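(* Let $1\le p\le2$, $2<q<\infty$, $\lambda>1$ and $m\ge1$. If $X$ is a Banach space and $Y$ is a (closed) subspace of an $\mathcal{L}_{p,\lambda}$-space, then $\mathcal{P}_{FSt,q}(^mX;Y)=\mathcal{P}_{FSt,2}(^mX;Y)$.
   Context: Scalars $\mathbb{K}=\mathbb{R}$ or $\mathbb{C}$. For $1\le p\le\infty$ and $\lambda>1$, a Banach space $Z$ is an $\mathcal{L}_{p,\lambda}$-space if every finite-dimensional subspace $E$ of $Z$ is contained in a finite-dimensional subspace $F$ of $Z$ for which there is an isomorphism $v:F\to\ell_p^{\dim F}$ with $\|v\|\cdot\|v^{-1}\|<\lambda$. $\mathcal{P}(^mX;Y)$ is the space of continuous $m$-homogeneous polynomials from $X$ to $Y$, and $\mathcal{P}(^mX)=\mathcal{P}(^mX;\mathbb{K})$ with the sup norm on the unit ball of $X$. For $1\le r<\infty$, $\mathcal{P}_{FSt,r}(^mX;Y)$ (factorable strongly $r$-summing polynomials) consists of those $P\in\mathcal{P}(^mX;Y)$ for which there is $C\ge0$ such that for all positive integers $m_1,m_2$, all $x_j^i\in X$ and all scalars $\lambda_j^i$ ($1\le j\le m_1$, $1\le i\le m_2$), $$\left(\sum_{j=1}^{m_1}\Big\|\sum_{i=1}^{m_2}\lambda_j^iP(x_j^i)\Big\|^r\right)^{1/r}\le C\sup_{h\in\mathcal{P}(^mX),\,\|h\|\le1}\left(\sum_{j=1}^{m_1}\Big|\sum_{i=1}^{m_2}\lambda_j^ih(x_j^i)\Big|^r\right)^{1/r}.$$ *)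

(* Defs.v *)
From HB Require Import structures.
From mathcomp Require Import all_boot all_order all_algebra.
From mathcomp Require Import complex.
From mathcomp Require Import all_classical all_reals all_analysis.

Set Implicit Arguments.
Unset Strict Implicit.
Unset Printing Implicit Defensive.

Import Order.TTheory GRing.Theory Num.Theory.
Import numFieldNormedType.Exports.
Local Open Scope classical_set_scope.
Local Open Scope ring_scope.

Inductive scalar_kind := RealScalars | ComplexScalars.

Definition scalars (R : realType) (k : scalar_kind) : numFieldType :=
  match k with
  | RealScalars => R : numFieldType
  | ComplexScalars => R[i] : numFieldType
  end.

(* A norm over the scalar field K takes its values in K; these values are real
   and [real_of] reads them in R. *)
Definition real_of (R : realType) (k : scalar_kind) : scalars R k -> R :=
  match k return scalars R k -> R with
  | RealScalars => fun x => x
  | ComplexScalars => fun z => complex.Re z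
  end.

Section Norms.
Variables (R : realType) (k : scalar_kind).
Local Notation K := (scalars R k).

(* Applies to vectors and, with V := K, to the modulus of scalars. *)
Definition rnorm (V : normedZmodType K) (x : V) : R := real_of `|x|.

Definition lp_norm (p : \bar R) (n : nat) (c : 'rV[K]_n) : R :=
  match p with
  | EFin p => (\sum_(i < n) rnorm (c 0 i) `^ p) `^ p^-1
  | +oo%E => \big[Num.max/0]_(i < n) rnorm (c 0 i)
  | -oo%E => 0
  end.

End Norms.

Section LpSpaces.
Variables (R : realType) (k : scalar_kind).
Local Notation K := (scalars R k).
Variable Z : normedModType K.

Definition subspace_of_dim (n : nat) (E : set Z) : Prop :=
  exists b : 'I_n -> Z,
    (forall c : 'rV[K]_n, \sum_(i < n) c 0 i *: b i = 0 -> c = 0) /\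
    E = range (fun c : 'rV[K]_n => \sum_(i < n) c 0 i *: b i).

(* v : F -> l_p^n is a linear bijection with inverse w, and
   ||v|| * ||w|| < lambda.  The values of v outside F are irrelevant.
   The suprema are taken in \bar R, where they are never junk values. *)
Definition lp_isomorphism (p : \bar R) (lambda : R) (n : nat) (F : set Z)
    (v : Z -> 'rV[K]_n) (w : 'rV[K]_n -> Z) : Prop :=
  [/\ forall (a : K) (x y : Z), F x -> F y -> v (a *: x + y) = a *: v x + v y,
      forall x : Z, F x -> w (v x) = x,
      forall c : 'rV[K]_n, F (w c) /\ v (w c) = c &
      (ereal_sup [set (lp_norm p (v x))%:E | x in [set x | F x /\ (rnorm x <= 1)%R]] *
       ereal_sup [set (rnorm (w c))%:E | c in [set c | (lp_norm p c <= 1)%R]]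
       < lambda%:E)%E].

Definition Lp_space (p : \bar R) (lambda : R) : Prop :=
  forall (d : nat) (E : set Z), subspace_of_dim d E ->
    exists (n : nat) (F : set Z),
      [/\ subspace_of_dim n F, E `<=` F &
          exists (v : Z -> 'rV[K]_n) (w : 'rV[K]_n -> Z),
            lp_isomorphism p lambda F v w].

End LpSpaces.

Section Polynomials.
Variables (R : realType) (k : scalar_kind).
Local Notation K := (scalars R k).

Definition multilinear_map (m : nat) (X Y : normedModType K)
    (A : ('I_m -> X) -> Y) : Prop :=
  forall (i : 'I_m) (x : 'I_m -> X), linear (fun u : X => A (dfwith x i u)).

Definition continuous_polynomials (m : nat) (X Y : normedModType K) :
    set (X -> Y) :=
  [set P | continuous P /\
     exists A : ('I_m -> X) -> Y,
       multilinear_map A /\ forall x, P x = A (fun=> x)].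

Definition poly_norm (X Y : normedModType K) (P : X -> Y) : \bar R :=
  ereal_sup [set (rnorm (P x))%:E | x in [set x : X | rnorm x <= 1]].

Definition scalar_poly_ball (m : nat) (X : normedModType K) : set (X -> K^o) :=
  [set h | continuous_polynomials m h /\ (poly_norm h <= 1)%E].

Definition summing_norm (r : R) (m1 m2 : nat) (Y : normedModType K)
    (l : 'I_m1 -> 'I_m2 -> K) (y : 'I_m1 -> 'I_m2 -> Y) : R :=
  (\sum_(j < m1) rnorm (\sum_(i < m2) l j i *: y j i) `^ r) `^ r^-1.

Definition factorable_strongly_summing (r : R) (m : nat)
    (X Y : normedModType K) : set (X -> Y) :=
  [set P | continuous_polynomials m P /\
     exists C : R, 0 <= C /\
       forall (m1 m2 : nat) (x : 'I_m1 -> 'I_m2 -> X)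
              (l : 'I_m1 -> 'I_m2 -> K),
         (0 < m1)%N -> (0 < m2)%N ->
         ((summing_norm r l (fun j i => P (x j i)))%:E
          <= C%:E * ereal_sup
               [set (summing_norm r l (fun j i => h (x j i)))%:E
               | h in @scalar_poly_ball m X])%E].

End Polynomials.

Arguments factorable_strongly_summing {R k} r m X Y.
Arguments continuous_polynomials {R k} m X Y.
Arguments Lp_space {R k} Z p lambda.

(* Main.v *)
Require Import Defs.
From HB Require Import structures.
From mathcomp Require Import all_boot all_order all_algebra.
From mathcomp Require Import complex ring lra.
From mathcomp Require Import all_classical all_reals all_analysis.
Import Order.TTheory GRing.Theory Num.Theory.
Import numFieldNormedType.Exports.
Local Open Scope classical_set_scope.
Local Open Scope ring_scope.

Set Implicit Arguments.
Unset Strict Implicit.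
Unset Printing Implicit Defensive.

(** Write T for the linearization of the polynomial P: a finite family of scalars
    l_i and points x_i represents a linear combination z of evaluations, with
    T z = sum of l_i P(x_i) and h(z) = sum of l_i h(x_i) for a scalar polynomial
    h.  In these terms P is factorable strongly r-summing exactly when
    (sum of |T z_j|^r)^(1/r) <= C sup_h (sum of |h(z_j)|^r)^(1/r) for all finite
    families of such z_j, so the claim is the analogue of the theorem of Maurey
    that q-summing and 2-summing operators into a space of cotype 2 coincide.

    From q to 2.  A space of type L_p with p <= 2 has cotype 2, hence so does Y:
    (sum of |T z_j|^2)^(1/2) is at most a constant times the q-th moment of
    |sum of e_j T z_j| over random signs e ([Lp_space_cotype2]).  This moment is a
    q-th power sum over the finite family of the vectors sum of e_j z_j, one for
    each choice of signs, so the q-summing inequality applies to that family; for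
    each h the resulting moment of |sum of e_j h(z_j)| is at most a constant times
    (sum of |h(z_j)|^2)^(1/2) by Khintchine's inequality ([khintchine_le]).  See
    [factorable_summing_cotype2].

    Cotype 2 is a property of finitely many vectors, hence of l_p^n uniformly in
    n.  There it follows from Khintchine's lower inequality in each coordinate
    ([khintchine_ge]) and the exchange of the l_2 and l_p norms ([mixed_norm_le]).

    From 2 to q.  Multiplying z_j by |T z_j|^(q/2 - 1) turns the sum of squares
    of the images into the sum of |T z_j|^q, and Hoelder's inequality controls the
    right-hand side ([hoelder_weights], [factorable_summing2_sub]).

    All convexity used is Jensen's inequality for concave powers
    ([jensen_powR]); Khintchine's inequalities come from the exponential moment
    of a signed sum. *)

(** * Elementary inequalities for powers *)

Section ConcavePower.
Variable R : realType.
Implicit Types (s t x y : R).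

(** The tangent line at 1 of the concave power; equivalently, Young's inequality
    with one factor equal to 1. *)
Lemma powR_tangent s t : 0 < s -> s <= 1 -> 0 <= t -> t `^ s <= 1 - s + s * t.
Proof.
move=> s0; rewrite le_eqVlt => /predU1P[-> t0|s1 t0].
  by rewrite powRr1// subrr add0r mul1r.
have sv : 0 < s^-1 by rewrite invr_gt0.
have s'v : 0 < (1 - s)^-1 by rewrite invr_gt0 subr_gt0.
have := @conjugate_powR R (t `^ s) 1 s^-1 (1 - s)^-1 (powR_ge0 _ _) ler01 sv s'v.
rewrite !invrK subrKC => /(_ erefl).
by rewrite mulr1 -powRrM mulfV ?gt_eqF// powRr1// powR1 mul1r addrC (mulrC t).
Qed.

(** Jensen's inequality for a concave power, by summing [powR_tangent] at the
    points t i divided by the mean. *)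
Lemma jensen_powR (I : finType) (w t : I -> R) s : 0 < s -> s <= 1 ->
  (forall i, 0 <= w i) -> \sum_i w i = 1 -> (forall i, 0 <= t i) ->
  \sum_i w i * t i `^ s <= (\sum_i w i * t i) `^ s.
Proof.
move=> s0 s1 w0 w1 t0.
have wt0 i : 0 <= w i * t i by rewrite mulr_ge0.
set M := \sum_i w i * t i.
have M0 : 0 <= M by apply: sumr_ge0 => i _.
have [Mz|Mn] := eqVneq M 0.
  rewrite Mz powR0 ?gt_eqF// big1// => i _.
  have /eqP := Mz; rewrite psumr_eq0// => /allP/(_ i (mem_index_enum _)) /=.
  rewrite mulf_eq0 => /orP[/eqP->|/eqP->]; first by rewrite mul0r.
  by rewrite powR0 ?mulr0// gt_eqF.
have Mp : 0 < M by rewrite lt_neqAle eq_sym Mn.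
have tE i : w i * t i `^ s = w i * (t i / M) `^ s * M `^ s.
  by rewrite -mulrA -powRM ?divr_ge0// divfK.
under eq_bigr do rewrite tE.
rewrite -mulr_suml -[leRHS]mul1r ler_wpM2r ?powR_ge0//.
apply: (@le_trans _ _ (\sum_i (w i * (1 - s) + s / M * (w i * t i)))).
  apply: ler_sum => i _.
  have -> : w i * (1 - s) + s / M * (w i * t i)
            = w i * (1 - s + s * (t i / M)) by ring.
  by rewrite ler_wpM2l// powR_tangent// divr_ge0.
rewrite big_split/= -mulr_suml w1 -mulr_sumr -/M divfK//.
by rewrite mul1r subrK.
Qed.

End ConcavePower.

Section PowerBounds.
Variable R : realType.
Implicit Types (q t x : R).

(** Sub-Gaussian estimate for one sign.  The constant 2 in the exponent is not
    optimal, but it only requires [expR_ge1Dx]. *)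
Lemma cosh_le x : expR x + expR (- x) <= 2 * expR (2 * x ^+ 2).
Proof.
wlog x0 : x / 0 <= x => [H|].
  have [/H//|/ltW x0] := leP 0 x.
  by have := H (- x); rewrite opprK sqrrN oppr_ge0 addrC; exact.
have e1 y : 0 < 1 - y -> expR y <= (1 - y)^-1.
  move=> y1; rewrite -[expR y]invrK -expRN lef_pV2 ?posrE ?expR_gt0//.
  exact: expR_ge1Dx.
have [x2|x2] := leP x (2^-1).
  apply: (@le_trans _ _ ((1 - x)^-1 + (1 + x)^-1)).
    by apply: lerD; [apply: e1|rewrite -[in leRHS](opprK x) e1]; lra.
  apply: (@le_trans _ _ (2 * (1 + 2 * x ^+ 2))); last first.
    by rewrite ler_wpM2l// expR_ge1Dx.
  have -> : (1 - x)^-1 + (1 + x)^-1 = 2 / (1 - x ^+ 2).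
    by field; apply/and3P; split; apply/eqP; nra.
  rewrite ler_pdivrMr; last by nra.
  have : x ^+ 2 <= 4^-1 by nra.
  have : 0 <= x ^+ 2 by rewrite sqr_ge0.
  nra.
rewrite mulr_natl mulr2n; apply: lerD; rewrite ler_expR; nra.
Qed.

Lemma powR_le_expR q : 0 < q ->
  exists2 A : R, 0 <= A & forall t, 0 <= t -> t `^ q <= A * expR t.
Proof.
move=> q0; pose n := Num.bound q.
have qn : q <= n.+1%:R.
  by have := archi_boundP (ltW q0); rewrite -/n -natr1; lra.
(* (n+1)! comes from the term of degree n+1 in the exponential series *)
exists (n.+1`!)%:R => // t t0.
have f1 : 1 <= (n.+1`!)%:R :> R by rewrite ler1n fact_gt0.
have [t1|t1] := leP t 1.
  apply: (@le_trans _ _ 1); last first.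
    by rewrite -[leLHS]mulr1 ler_pM// -expR0 ler_expR.
  have -> : 1 = 1 `^ q :> R by rewrite powR1.
  by rewrite ge0_ler_powR ?nnegrE// ltW.
apply: (@le_trans _ _ (t `^ n.+1%:R)); first by rewrite ler_powR// ltW.
rewrite powR_mulrn// mulrC -ler_pdivrMr ?ltr0n ?fact_gt0//.
by have := expR_ge1Dxn n t0; lra.
Qed.

(** The right-hand side is at least t^2 for t below 1 and at least t above, and
    the left-hand side is negative for t above a.  Averaging this inequality
    bounds the p-th moment from below by the second and fourth moments. *)
Lemma powR_ge_quartic (p a t : R) : 1 <= p -> p <= 2 -> 1 <= a -> 0 <= t ->
  (t ^+ 2 - t ^+ 4 / a) / a <= t `^ p.
Proof.
move=> p1 p2 a1 t0.
have a0 : 0 < a by lra.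
rewrite ler_pdivrMr//.
have [t1|t1] := leP t 1.
  have tp : t ^+ 2 <= t `^ p.
    have [->|tn] := eqVneq t 0; first by rewrite expr0n/= powR_ge0.
    by rewrite -powR_mulrn// ger_powR// t1 andbT lt_neqAle eq_sym tn//.
  apply: (@le_trans _ _ (t ^+ 2)); first by rewrite gerBl divr_ge0 ?exprn_ge0// ltW.
  by apply: le_trans tp _; rewrite ler_peMr// powR_ge0.
apply: (@le_trans _ _ (t * a)); last first.
  by rewrite (ler_wpM2r (ltW a0))// le1r_powR// ltW.
have [ta|ta] := leP t a; first have : 0 <= t ^+ 4 / a.
- by rewrite divr_ge0 ?exprn_ge0// ltW.
- by nra.
have t24 : t ^+ 2 <= t ^+ 4 / a.
  have at2 : a <= t ^+ 2 by nra.
  by rewrite ler_pdivlMr// (exprM t 2 2) expr2 ler_wpM2l ?sqr_ge0.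
have ta0 : 0 <= t * a by nra.
lra.
Qed.

Lemma powRD_le (q x y : R) : 0 <= q -> 0 <= x -> 0 <= y ->
  (x + y) `^ q <= 2 `^ q * (x `^ q + y `^ q).
Proof.
move=> q0; wlog xy : x y / x <= y => [H x0 y0|x0 y0].
  have [xy|/ltW xy] := leP x y; first exact: H.
  by rewrite addrC (addrC (x `^ q)) H.
apply: (@le_trans _ _ ((2 * y) `^ q)).
  by rewrite ge0_ler_powR ?nnegrE ?addr_ge0 ?mulr_ge0//; lra.
by rewrite powRM// ler_wpM2l ?powR_ge0// lerDr powR_ge0.
Qed.

End PowerBounds.

(** * Averages over signs *)

Section SignMeans.
Variables (R : realType) (I : finType).
Local Notation signs := {ffun I -> bool}.
Implicit Types (f g : signs -> R) (a : I -> R) (e : signs).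

(** The average of [f] over all choices of signs; the boolean [e i] stands for
    the sign [(-1) ^+ e i]. *)
Definition sign_mean f : R := (\sum_e f e) / #|{: signs}|%:R.

Lemma card_signs_gt0 : (0 < #|{: signs}|)%N.
Proof. by apply/card_gt0P; exists [ffun=> true]. Qed.

Let card0 : 0 < #|{: signs}|%:R :> R.
Proof. by rewrite ltr0n card_signs_gt0. Qed.

Lemma card_sign_mean f : #|{: signs}|%:R * sign_mean f = \sum_e f e.
Proof. by rewrite mulrC divfK ?gt_eqF. Qed.

Lemma sign_mean_ge0 f : (forall e, 0 <= f e) -> 0 <= sign_mean f.
Proof. by move=> f0; rewrite divr_ge0// sumr_ge0. Qed.

Lemma ler_sign_mean f g : (forall e, f e <= g e) -> sign_mean f <= sign_mean g.
Proof. by move=> fg; rewrite ler_wpM2r ?invr_ge0// ler_sum. Qed.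

Lemma eq_sign_mean f g : f =1 g -> sign_mean f = sign_mean g.
Proof. by move=> fg; rewrite /sign_mean (eq_bigr _ (fun e _ => fg e)). Qed.

Lemma sign_meanD f g :
  sign_mean (fun e => f e + g e) = sign_mean f + sign_mean g.
Proof. by rewrite /sign_mean big_split mulrDl. Qed.

Lemma sign_meanZ c f : sign_mean (fun e => c * f e) = c * sign_mean f.
Proof. by rewrite /sign_mean -mulr_sumr mulrA. Qed.

Lemma sign_mean_sum (J : finType) (F : J -> signs -> R) :
  sign_mean (fun e => \sum_j F j e) = \sum_j sign_mean (F j).
Proof. by rewrite /sign_mean exchange_big mulr_suml. Qed.

(** Independence of the signs. *)
Lemma sign_mean_prod (F : I -> bool -> R) :
  sign_mean (fun e => \prod_i F i (e i)) = \prod_i ((F i true + F i false) / 2).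
Proof.
rewrite big_split /= prodr_const /sign_mean; congr (_ * _).
  by rewrite -bigA_distr_bigA; apply: eq_bigr => i _; rewrite big_bool.
by rewrite card_ffun card_bool natrX exprVn.
Qed.

Lemma sign_mean_jensen f s : 0 < s -> s <= 1 -> (forall e, 0 <= f e) ->
  sign_mean (fun e => f e `^ s) <= sign_mean f `^ s.
Proof.
move=> s0 s1 f0; have := @jensen_powR R _ (fun=> #|{: signs}|%:R^-1) f s s0 s1.
rewrite -!mulr_sumr !(mulrC #|_|%:R^-1); apply=> //.
by rewrite sumr_const -[_ *+ _]mulr_natr mulVf ?gt_eqF.
Qed.

(** The exponential moment factorizes into hyperbolic cosines. *)
Lemma sign_mean_expR_le a :
  sign_mean (fun e => expR (\sum_i (-1) ^+ e i * a i))
  <= expR (2 * \sum_i a i ^+ 2).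
Proof.
under eq_sign_mean do rewrite expR_sum.
rewrite (sign_mean_prod (fun i b => expR ((-1) ^+ b * a i))).
rewrite mulr_sumr expR_sum; apply: ler_prod => i _.
rewrite divr_ge0 ?addr_ge0 ?expR_ge0//= expr1 expr0 mulN1r mul1r.
by rewrite ler_pdivrMr// mulrC addrC cosh_le.
Qed.

Lemma sign_mean_sign2 (i j : I) :
  sign_mean (fun e => (-1) ^+ e i * (-1) ^+ e j) = (i == j)%:R.
Proof.
have [<-|ij] := eqVneq i j.
  under eq_sign_mean do rewrite -expr2 sqrr_sign.
  by rewrite /sign_mean sumr_const -[_ *+ _]mulr_natr mul1r divff ?gt_eqF.
pose F l (b : bool) : R :=
  (if l == i then (-1) ^+ b else 1) * (if l == j then (-1) ^+ b else 1).
transitivity (sign_mean (fun e => \prod_l F l (e l))).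
  by apply: eq_sign_mean => e; rewrite big_split /= -!big_mkcond !big_pred1_eq.
rewrite sign_mean_prod (bigD1 i)//= /F eqxx (negbTE ij) !mulr1 expr1 expr0.
by rewrite addNr !mul0r.
Qed.

Lemma sign_mean_sqr a :
  sign_mean (fun e => (\sum_i (-1) ^+ e i * a i) ^+ 2) = \sum_i a i ^+ 2.
Proof.
under eq_sign_mean => e do rewrite expr2 big_distrl/=.
rewrite sign_mean_sum; apply: eq_bigr => i _.
under eq_sign_mean => e do rewrite big_distrr/=.
rewrite sign_mean_sum (bigD1 i)//= big1 => [|j ji]; last first.
  under eq_sign_mean do rewrite mulrACA mulrC.
  by rewrite sign_meanZ sign_mean_sign2 eq_sym (negbTE ji) mulr0.
under eq_sign_mean do rewrite mulrACA mulrC.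
by rewrite sign_meanZ sign_mean_sign2 eqxx mulr1 addr0 expr2.
Qed.

End SignMeans.

(** * Khintchine's upper inequality for real coefficients *)

Section RealKhintchine.
Variable R : realType.

Lemma khintchine_real (q : R) : 0 < q ->
  exists2 B : R, 0 <= B & forall (I : finType) (a : I -> R),
    sign_mean (fun e => `|\sum_i (-1) ^+ e i * a i| `^ q)
    <= B * (\sum_i a i ^+ 2) `^ (q / 2).
Proof.
move=> q0; have [A A0 hA] := @powR_le_expR R q q0.
exists (A * (2 * expR 2)) => [|I a].
  by rewrite !mulr_ge0// expR_ge0.
set s2 := \sum_i _ ^+ 2.
have s20 : 0 <= s2 by apply: sumr_ge0 => i _; rewrite sqr_ge0.
have [s2z|s2n] := eqVneq s2 0.
  have az i : a i = 0.
    have /eqP := s2z; rewrite psumr_eq0 => [|l _]; last exact: sqr_ge0.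
    by move=> /allP/(_ i (mem_index_enum _)) /=; rewrite sqrf_eq0 => /eqP.
  rewrite (@eq_sign_mean _ _ _ (fun=> 0 * 0)) => [|e]; last first.
    by rewrite big1 => [|i _]; rewrite ?az ?mulr0// normr0 powR0// gt_eqF.
  by rewrite sign_meanZ mul0r !mulr_ge0 ?powR_ge0// expR_ge0.
pose s := Num.sqrt s2.
have sp : 0 < s by rewrite sqrtr_gt0 lt_neqAle eq_sym s2n.
have sE : s2 `^ (q / 2) = s `^ q.
  by rewrite mulrC powRrM powR12_sqrt.
(* the normalized signed sum, for b = 1, and its opposite, for b = -1 *)
pose T b (e : {ffun I -> bool}) := \sum_i (-1) ^+ e i * (b * (a i / s)) : R.
have TE b : b ^+ 2 = 1 ->
    sign_mean (fun e => expR (T b e)) <= expR 2.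
  move=> b2; apply: le_trans (sign_mean_expR_le _) _.
  rewrite ler_expR -[leRHS]mulr1 ler_wpM2l//.
  under eq_bigr do rewrite exprMn b2 mul1r exprMn.
  by rewrite -mulr_suml exprVn sqr_sqrtr// divff.
rewrite sE mulrC.
apply: (@le_trans _ _ (sign_mean (fun e =>
    (s `^ q * A) * (expR (T 1 e) + expR (T (-1) e))))).
  apply: ler_sign_mean => e.
  have -> : \sum_i (-1) ^+ e i * a i = s * T 1 e.
    rewrite /T mulr_sumr; apply: eq_bigr => i _.
    by field; rewrite gt_eqF.
  have -> : T (-1) e = - T 1 e.
    by rewrite /T -sumrN; apply: eq_bigr => i _; rewrite !mulN1r mul1r mulrN.
  rewrite normrM gtr0_norm// powRM ?(ltW sp)//.
rewrite -mulrA ler_wpM2l ?powR_ge0//.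
  apply: le_trans (hA _ (normr_ge0 _)) _; rewrite ler_wpM2l//.
  have [t0|t0] := leP 0 (T 1 e).
    by rewrite ger0_norm// lerDl expR_ge0.
  by rewrite ltr0_norm// lerDr expR_ge0.
rewrite sign_meanZ sign_meanD -mulrA ler_wpM2l ?powR_ge0// ler_wpM2l//.
by rewrite mulr_natl mulr2n lerD// TE// ?sqrrN expr1n.
Qed.

End RealKhintchine.

(** * Real and imaginary parts of scalars, real-valued norms *)

Section ScalarKind.
Variables (R : realType) (k : scalar_kind).
Local Notation K := (scalars R k).

(** The imaginary part of a scalar, zero when the scalars are real; [real_of]
    is the real part. *)
Definition imag_of : K -> R :=
  match k return scalars R k -> R with
  | RealScalars => fun=> 0
  | ComplexScalars => fun z => complex.Im z
  end.

(** The embedding of the real line into the scalar field. *)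
Definition of_real : R -> K :=
  match k return R -> scalars R k with
  | RealScalars => fun x => x
  | ComplexScalars => fun x => (x%:C)%C
  end.

Lemma real_of_sum (I : finType) (f : I -> K) :
  real_of (\sum_i f i) = \sum_i real_of (f i).
Proof.
apply: (big_morph (@real_of R k)); rewrite /real_of; last by case: (k).
by case: (k) => // -[a b] [c d].
Qed.

Lemma imag_of_sum (I : finType) (f : I -> K) :
  imag_of (\sum_i f i) = \sum_i imag_of (f i).
Proof.
apply: (big_morph imag_of); rewrite /imag_of; last by case: (k).
by case: (k) => [x y|[a b] [c d]]//; rewrite addr0.
Qed.

Lemma real_of_sign (b : bool) (z : K) :
  real_of ((-1) ^+ b * z) = (-1) ^+ b * real_of z.
Proof.
case: b; rewrite ?expr1 ?expr0 ?mul1r// !mulN1r /real_of.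
by case: (k) z => // -[].
Qed.

Lemma imag_of_sign (b : bool) (z : K) :
  imag_of ((-1) ^+ b * z) = (-1) ^+ b * imag_of z.
Proof.
case: b; rewrite ?expr1 ?expr0 ?mul1r// !mulN1r /imag_of.
by case: (k) z => [|[]]//; rewrite oppr0.
Qed.

Lemma of_realK (x : R) : real_of (of_real x) = x.
Proof. by rewrite /of_real /real_of; case: (k). Qed.

Lemma ge0_of_real (z : K) : 0 <= z -> of_real (real_of z) = z /\ 0 <= real_of z.
Proof.
rewrite /of_real /real_of; case: (k) z => [//|[a b]].
by rewrite lecE /= => /andP[/eqP -> a0].
Qed.

Lemma of_realM (x y : R) : of_real (x * y) = of_real x * of_real y.
Proof. by rewrite /of_real; case: (k) => //; rewrite rmorphM. Qed.

Lemma of_real_ge0 (x : R) : 0 <= x -> 0 <= of_real x.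
Proof. by rewrite /of_real; case: (k) => // x0; rewrite lecR. Qed.

Lemma rnorm_ge0 (V : normedZmodType K) (x : V) : 0 <= rnorm x.
Proof. by have [] := ge0_of_real (normr_ge0 x). Qed.

Lemma rnormE (V : normedZmodType K) (x : V) : `|x| = of_real (rnorm x).
Proof. by have [-> _] := ge0_of_real (normr_ge0 x). Qed.

Lemma rnorm_eq0 (V : normedZmodType K) (x : V) : (rnorm x == 0) = (x == 0).
Proof.
apply/eqP/eqP => [|->].
  move=> x0; apply/normr0_eq0; rewrite rnormE x0 /of_real.
  by case: (k).
rewrite /rnorm normr0 /real_of.
by case: (k).
Qed.

Lemma rnormZ (V : normedModType K) (a : K) (x : V) :
  rnorm (a *: x) = rnorm a * rnorm x.
Proof.
by rewrite {1}/rnorm normrZ (rnormE a) (rnormE x) -of_realM of_realK.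
Qed.

Lemma rnormM (a b : K) : rnorm (a * b) = rnorm a * rnorm b.
Proof.
by rewrite {1}/rnorm normrM (rnormE a) (rnormE b) -of_realM of_realK.
Qed.

Lemma rnorm_of_real (x : R) : 0 <= x -> rnorm (of_real x) = x.
Proof. by move=> x0; rewrite /rnorm ger0_norm ?of_realK ?of_real_ge0. Qed.

Lemma rnorm_sqr (z : K) : rnorm z ^+ 2 = real_of z ^+ 2 + imag_of z ^+ 2.
Proof.
rewrite /rnorm /real_of /imag_of; case: (k) z => [x|[a b]].
  by rewrite real_normK ?num_real// expr0n addr0.
by rewrite normc_def /= sqr_sqrtr// addr_ge0// sqr_ge0.
Qed.

Lemma rnorm_le (z : K) : rnorm z <= `|real_of z| + `|imag_of z|.
Proof.
rewrite -[leLHS]ger0_norm ?rnorm_ge0// -[leRHS]ger0_norm ?addr_ge0//.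
rewrite -ler_sqr ?nnegrE// ger0_norm ?rnorm_ge0// rnorm_sqr.
rewrite [in leRHS]ger0_norm ?addr_ge0// sqrrD !real_normK ?num_real//.
by rewrite lerD2r lerDl mulrn_wge0// mulr_ge0.
Qed.

End ScalarKind.

(** * Khintchine's inequalities for real or complex coefficients *)

Section Khintchine.
Variables (R : realType) (k : scalar_kind).
Local Notation K := (scalars R k).

Lemma sign_mean_rnorm_sqr (I : finType) (a : I -> K) :
  sign_mean (fun e => rnorm (\sum_i (-1) ^+ e i * a i) ^+ 2)
  = \sum_i rnorm (a i) ^+ 2.
Proof.
under [RHS]eq_bigr do rewrite rnorm_sqr.
rewrite big_split /= -!sign_mean_sqr -sign_meanD; apply: eq_sign_mean => e.
rewrite rnorm_sqr real_of_sum imag_of_sum.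
under [X in X ^+ 2 + _]eq_bigr do rewrite real_of_sign.
by under [X in _ + X ^+ 2]eq_bigr do rewrite imag_of_sign.
Qed.

(** The real case applied to the real and imaginary parts. *)
Lemma khintchine_le (q : R) : 0 < q ->
  exists2 B : R, 0 <= B & forall (I : finType) (a : I -> K),
    sign_mean (fun e => rnorm (\sum_i (-1) ^+ e i * a i) `^ q)
    <= B * (\sum_i rnorm (a i) ^+ 2) `^ (q / 2).
Proof.
move=> q0; have [B B0 hB] := khintchine_real q0.
exists (2 `^ q * (B + B)) => [|I a].
  by rewrite mulr_ge0 ?powR_ge0// addr_ge0.
set s := \sum_i rnorm _ ^+ 2.
have le_s (b : I -> R) : (forall i, b i ^+ 2 <= rnorm (a i) ^+ 2) ->
    sign_mean (fun e => `|\sum_i (-1) ^+ e i * b i| `^ q) <= B * s `^ (q / 2).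
  move=> ba; apply: le_trans (hB I b) _; rewrite ler_wpM2l//.
  have ss : \sum_i b i ^+ 2 <= s by apply: ler_sum.
  by rewrite ge0_ler_powR ?nnegrE ?divr_ge0 ?(ltW q0)//;
    apply: sumr_ge0 => i _; rewrite sqr_ge0.
apply: (@le_trans _ _ (2 `^ q * (
    sign_mean (fun e => `|\sum_i (-1) ^+ e i * real_of (a i)| `^ q) +
    sign_mean (fun e => `|\sum_i (-1) ^+ e i * imag_of (a i)| `^ q)))).
  rewrite -sign_meanD -sign_meanZ; apply: ler_sign_mean => e.
  apply: le_trans (powRD_le (ltW q0) (normr_ge0 _) (normr_ge0 _)).
  rewrite -(eq_bigr _ (fun i _ => real_of_sign (e i) (a i))) -real_of_sum.
  rewrite -(eq_bigr _ (fun i _ => imag_of_sign (e i) (a i))) -imag_of_sum.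
  rewrite ge0_ler_powR ?nnegrE ?rnorm_ge0 ?addr_ge0//.
    exact: ltW.
  exact: rnorm_le.
rewrite -mulrA ler_wpM2l ?powR_ge0// mulrDl.
by apply: lerD; apply: le_s => i; rewrite rnorm_sqr ?lerDl ?lerDr sqr_ge0.
Qed.

(** The lower bound follows from the exact second moment and the upper bound
    on the fourth, through [powR_ge_quartic]. *)
Lemma khintchine_ge (p : R) : 1 <= p -> p <= 2 ->
  exists2 c : R, 0 < c & forall (I : finType) (a : I -> K),
    c * (\sum_i rnorm (a i) ^+ 2) `^ (p / 2)
    <= sign_mean (fun e => rnorm (\sum_i (-1) ^+ e i * a i) `^ p).
Proof.
move=> p1 p2; have [B B0 hB] := @khintchine_le 4 ltac:(done).
(* with D > 2 B the quartic term costs at most half of the second moment *)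
pose D := 2 * B + 1; have D1 : 1 <= D by rewrite /D; lra.
have D0 : 0 < D by lra.
exists (2^-1 / D) => [|I a]; first by rewrite divr_gt0.
set s2 := \sum_i _ ^+ 2.
have s20 : 0 <= s2 by apply: sumr_ge0 => i _; rewrite sqr_ge0.
have [s2z|s2n] := eqVneq s2 0.
  rewrite s2z powR0 ?mulr0; last by apply/eqP; lra.
  by apply: sign_mean_ge0 => e; rewrite powR_ge0.
pose s := Num.sqrt s2.
have sp : 0 < s by rewrite sqrtr_gt0 lt_neqAle eq_sym s2n.
have s2E : s2 = s ^+ 2 by rewrite sqr_sqrtr.
have -> : s2 `^ (p / 2) = s `^ p by rewrite mulrC powRrM powR12_sqrt.
have s42 : s2 `^ (4 / 2) = s ^+ 4.
  by rewrite (_ : 4 / 2 = 2) ?powR_mulrn// ?s2E -?exprM//; field.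
pose S (e : {ffun I -> bool}) : R := rnorm (\sum_i (-1) ^+ e i * a i).
have S0 e : 0 <= S e by exact: rnorm_ge0.
have S2 : sign_mean (fun e => S e ^+ 2) = s ^+ 2 by rewrite sign_mean_rnorm_sqr.
have S4 : sign_mean (fun e => S e ^+ 4) <= B * s ^+ 4.
  rewrite -s42; apply: le_trans (hB I a); apply: ler_sign_mean => e.
  by rewrite powR_mulrn// rnorm_ge0.
apply: (@le_trans _ _ (sign_mean (fun e =>
   s `^ p / D / s ^+ 2 * S e ^+ 2 + - (s `^ p / D / D / s ^+ 4) * S e ^+ 4))).
  rewrite sign_meanD !sign_meanZ S2.
  set r := s `^ p; have r0 : 0 <= r by exact: powR_ge0.
  have -> : r / D / s ^+ 2 * s ^+ 2 = r / D.
    by rewrite divfK// expf_neq0// gt_eqF.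
  have : r / D / D / s ^+ 4 * sign_mean (fun e => S e ^+ 4)
         <= r / D * 2^-1.
    apply: (@le_trans _ _ (r / D / D / s ^+ 4 * (B * s ^+ 4))).
      by rewrite ler_wpM2l// !divr_ge0// ?exprn_ge0// ltW.
    rewrite mulrCA divfK; last by rewrite expf_neq0// gt_eqF.
    rewrite mulrCA ler_wpM2l// ?divr_ge0 ?(ltW D0)//.
    by rewrite ler_pdivrMr// /D; lra.
  rewrite (_ : 2^-1 / D * r = r / D * 2^-1); last by ring.
  lra.
apply: ler_sign_mean => e.
have -> : rnorm (\sum_i (-1) ^+ e i * a i) = s * (S e / s).
  by rewrite mulrC divfK// gt_eqF.
rewrite powRM ?divr_ge0 ?(ltW sp)//.
apply: le_trans (_ : s `^ p * (((S e / s) ^+ 2 - (S e / s) ^+ 4 / D) / D) <= _).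
  rewrite le_eqVlt; apply/orP; left; apply/eqP; field.
  by rewrite !gt_eqF.
by rewrite ler_wpM2l ?powR_ge0// powR_ge_quartic// divr_ge0// ltW.
Qed.

End Khintchine.

(** * Cotype 2 of finite-dimensional l_p spaces *)

Section MixedNorms.
Variable R : realType.

Lemma sqr_powR_half (x p : R) : 0 <= x -> (x ^+ 2) `^ (p / 2) = x `^ p.
Proof.
by move=> x0; rewrite -powR_mulrn// -powRrM mulrCA mulfV ?mulr1.
Qed.

Lemma powRVK (x p : R) : 0 <= x -> p != 0 -> (x `^ p^-1) `^ p = x.
Proof. by move=> x0 p0; rewrite -powRrM mulVf// powRr1. Qed.

Lemma powRKV (x p : R) : 0 <= x -> p != 0 -> (x `^ p) `^ p^-1 = x.
Proof. by move=> x0 p0; rewrite -powRrM mulfV// powRr1. Qed.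

(** Exchanging the order of the l_2 and l_p norms, for p at most 2: this is
    Jensen's inequality for the power p / 2, with weights proportional to the
    squares of the inner l_p norms [N i]. *)
Lemma mixed_norm_le (I J : finType) (p : R) (b : I -> J -> R) (N : I -> R) :
  0 < p -> p <= 2 -> (forall i j, 0 <= b i j) -> (forall i, 0 <= N i) ->
  (forall i, N i `^ p = \sum_j b i j `^ p) ->
  (\sum_i N i ^+ 2) `^ (p / 2) <= \sum_j (\sum_i b i j ^+ 2) `^ (p / 2).
Proof.
move=> p0 p2 b0 N0 Np.
have p20 : 0 < p / 2 by rewrite divr_gt0.
have p21 : p / 2 <= 1 by rewrite ler_pdivrMr// mul1r.
set S := \sum_i N i ^+ 2.
have S0 : 0 <= S by apply: sumr_ge0 => i _; rewrite sqr_ge0.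
have [Sz|Sn] := eqVneq S 0.
  by rewrite Sz powR0 ?gt_eqF// sumr_ge0// => j _; rewrite powR_ge0.
have Sp : 0 < S by rewrite lt_neqAle eq_sym Sn.
pose w i := N i ^+ 2 / S.
have w0 i : 0 <= w i by rewrite divr_ge0 ?sqr_ge0.
have w1 : \sum_i w i = 1 by rewrite -mulr_suml mulfV.
pose t j i := (b i j / N i) ^+ 2.
have t0 j i : 0 <= t j i by rewrite sqr_ge0.
have wt1 : \sum_j \sum_i w i * t j i `^ (p / 2) = 1.
  rewrite exchange_big -[RHS]w1; apply: eq_bigr => i _.
  rewrite -mulr_sumr; have [Nz|Nn] := eqVneq (N i) 0.
    by rewrite /w Nz expr0n/= !mul0r.
  under eq_bigr => j _.
    rewrite /t sqr_powR_half ?divr_ge0// powRM ?invr_ge0// -powR_inv1// -powRrM.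
    over.
  rewrite -mulr_suml -Np -powRD ?Nn ?implybT//.
  by rewrite mulN1r subrr powRr0 mulr1.
rewrite -[leLHS]mulr1 -[X in _ * X <= _]wt1 mulr_sumr; apply: ler_sum => j _.
apply: (@le_trans _ _ (S `^ (p / 2) * (\sum_i w i * t j i) `^ (p / 2))).
  by rewrite ler_wpM2l ?powR_ge0// jensen_powR.
have wt0 : 0 <= \sum_i w i * t j i by apply: sumr_ge0 => i _; rewrite mulr_ge0.
rewrite -powRM// ge0_ler_powR ?nnegrE ?(ltW p20) ?mulr_ge0//.
  by apply: sumr_ge0 => i _; rewrite sqr_ge0.
rewrite mulr_sumr; apply: ler_sum => i _.
rewrite /w /t mulrA (mulrC S) divfK//.
have [->|Nn] := eqVneq (N i) 0; first by rewrite expr0n/= mul0r sqr_ge0.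
by rewrite exprMn exprVn mulrC divfK// expf_neq0.
Qed.

End MixedNorms.

Section LpNorm.
Variables (R : realType) (k : scalar_kind) (p : R).
Hypothesis p1 : 1 <= p.
Local Notation K := (scalars R k).

Let p0 : 0 < p. Proof. exact: lt_le_trans p1. Qed.
Let pn0 : p != 0. Proof. by rewrite gt_eqF. Qed.

Lemma lp_norm_ge0 n (c : 'rV[K]_n) : 0 <= lp_norm p%:E c.
Proof. exact: powR_ge0. Qed.

Lemma lp_norm_powR n (c : 'rV[K]_n) :
  lp_norm p%:E c `^ p = \sum_i rnorm (c 0 i) `^ p.
Proof. by rewrite /lp_norm powRVK// sumr_ge0// => i _; rewrite powR_ge0. Qed.

Lemma lp_norm_eq0 n (c : 'rV[K]_n) : lp_norm p%:E c = 0 -> c = 0.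
Proof.
move=> c0; have /esym/eqP := lp_norm_powR c; rewrite c0 powR0//.
rewrite psumr_eq0 => [/allP h|i _]; last exact: powR_ge0.
apply/rowP => i; have /eqP/powR_eq0_eq0/eqP := h i (mem_index_enum _).
by rewrite rnorm_eq0 => /eqP ->; rewrite mxE.
Qed.

Lemma lp_norm0 n : lp_norm p%:E (0 : 'rV[K]_n) = 0.
Proof.
rewrite /lp_norm big1 ?powR0 ?invr_eq0// => i _.
rewrite mxE; have /eqP -> : rnorm (0 : K) == 0 by rewrite rnorm_eq0.
by rewrite powR0.
Qed.

Lemma lp_normZ n (r : R) (c : 'rV[K]_n) : 0 <= r ->
  lp_norm p%:E (of_real k r *: c) = r * lp_norm p%:E c.
Proof.
move=> r0; rewrite /lp_norm -[in RHS](powRKV r0 pn0).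
have h0 i : 0 <= rnorm (c 0 i) by exact: rnorm_ge0.
rewrite -powRM ?powR_ge0// ?sumr_ge0// => [|i _]; last exact: powR_ge0.
congr (_ `^ _); rewrite mulr_sumr; apply: eq_bigr => i _.
by rewrite mxE rnormM rnorm_of_real// powRM.
Qed.

(** Cotype 2 of l_p^n with a constant independent of n: Khintchine's lower
    inequality in each coordinate, then [mixed_norm_le]. *)
Lemma lp_norm_cotype2 : p <= 2 ->
  exists2 c : R, 0 < c & forall (I : finType) n (u : I -> 'rV[K]_n),
    c * (\sum_i lp_norm p%:E (u i) ^+ 2) `^ (p / 2)
    <= sign_mean (fun e => lp_norm p%:E (\sum_i (-1) ^+ e i *: u i) `^ p).
Proof.
move=> p2; have [c c0 hc] := @khintchine_ge R k p p1 p2.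
exists c => // I n u.
apply: (@le_trans _ _
  (c * \sum_(l < n) (\sum_i rnorm (u i 0 l) ^+ 2) `^ (p / 2))).
  rewrite ler_wpM2l ?(ltW c0)//.
  apply: (@mixed_norm_le _ _ _ p (fun i l => rnorm (u i 0 l))) => //.
  - by move=> i l; exact: rnorm_ge0.
  - by move=> i; exact: lp_norm_ge0.
  - by move=> i; exact: lp_norm_powR.
rewrite mulr_sumr.
rewrite (@eq_sign_mean _ _ _ (fun e => \sum_(l < n)
   rnorm (\sum_i (-1) ^+ e i * u i 0 l) `^ p)) => [|e].
  by rewrite sign_mean_sum; apply: ler_sum => l _; exact: hc.
rewrite lp_norm_powR; apply: eq_bigr => l _; rewrite summxE.
by under [in LHS]eq_bigr do rewrite mxE.
Qed.

End LpNorm.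

(** * Cotype 2 of L_p spaces *)

Section Subspaces.
Variables (R : realType) (k : scalar_kind).
Local Notation K := (scalars R k).
Variable V : normedModType K.

Lemma linear_on0 (W : lmodType K) (F : set V) (v : V -> W) : F 0 ->
  (forall (a : K) x y, F x -> F y -> v (a *: x + y) = a *: v x + v y) ->
  v 0 = 0.
Proof.
move=> F0 vlin; have := vlin 1 0 0 F0 F0; rewrite !scale1r addr0 => /eqP.
by rewrite -subr_eq0 opprD addNKr oppr_eq0 => /eqP.
Qed.

Lemma subspace_lin n (F : set V) : subspace_of_dim n F ->
  F 0 /\ forall (a : K) x y, F x -> F y -> F (a *: x + y).
Proof.
move=> [b [_ ->]]; split.
  by exists 0 => //; rewrite big1// => i _; rewrite mxE scale0r.
move=> a x y [c _ <-] [d _ <-]; exists (a *: c + d) => //.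
rewrite scaler_sumr -big_split; apply: eq_bigr => i _.
by rewrite !mxE scalerDl scalerA.
Qed.

(** [subspace_of_dim] requires a basis, so a basis of the span is extracted from
    the family one vector at a time. *)
Lemma seq_in_subspace (s : seq V) :
  exists d (E : set V), subspace_of_dim d E /\ {in s, forall x, E x}.
Proof.
elim: s => [|x s [d [E [Ed Es]]]].
  exists 0%N, (range (fun c : 'rV[K]_0 => \sum_(i < 0) c 0 i *: (0 : V))).
  split=> //; exists (fun=> 0); split=> // c _; exact: thinmx0.
have [Ex|nEx] := pselect (E x).
  exists d, E; split=> // y; rewrite in_cons => /predU1P[->//|]; exact: Es.
have [E0 Elin] := subspace_lin Ed.
have [b [bfree bE]] := Ed.
pose b' (i : 'I_d.+1) := if unlift ord0 i is Some l then b l else x.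
pose tl (c : 'rV[K]_d.+1) : 'rV[K]_d := \row_l c 0 (lift ord0 l).
have sumE (c : 'rV[K]_d.+1) :
    \sum_i c 0 i *: b' i = c 0 ord0 *: x + \sum_i tl c 0 i *: b i.
  rewrite big_ord_recl /b' unlift_none; congr (_ + _).
  by apply: eq_bigr => l _; rewrite liftK mxE.
have inE (c : 'rV[K]_d) : E (\sum_i c 0 i *: b i) by rewrite bE; exists c.
exists d.+1, (range (fun c : 'rV[K]_d.+1 => \sum_i c 0 i *: b' i)); split.
  exists b'; split=> // c; rewrite sumE => c0.
  have c00 : c 0 ord0 = 0.
    apply/eqP/negP => /negP cn; apply: nEx.
    have -> : x = - (c 0 ord0)^-1 *: (\sum_i tl c 0 i *: b i) + 0.
      rewrite addr0 scaleNr -scalerN.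
      move/eqP: c0; rewrite addr_eq0 => /eqP <-.
      by rewrite scalerA mulVf// scale1r.
    exact: Elin.
  move: c0; rewrite c00 scale0r add0r => /bfree tl0.
  apply/rowP => i; rewrite mxE; case: (unliftP ord0 i) => [l ->|->//].
  by have /rowP/(_ l) := tl0; rewrite !mxE.
move=> y; rewrite in_cons => /predU1P[->|/Es].
  exists (\row_i (i == ord0)%:R) => //.
  rewrite sumE mxE eqxx scale1r big1 ?addr0// => l _.
  by rewrite !mxE scale0r.
rewrite bE => -[c _ <-].
exists (\row_i if unlift ord0 i is Some l then c 0 l else 0) => //.
rewrite sumE mxE unlift_none scale0r add0r.
by apply: eq_bigr => l _; rewrite !mxE liftK.
Qed.

(** Two-sided norm estimates on [F] with real constants.  The product of
    suprema gives |x| * |v x'| <= lambda * |x'| * |v x| for all x, x' in F;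
    fixing one of the two vectors yields each estimate, at the cost of one more
    factor lambda. *)
Lemma lp_isomorphism_bounds (p lambda : R) n (F : set V)
    (v : V -> 'rV[K]_n) (w : 'rV[K]_n -> V) : 1 <= p ->
  subspace_of_dim n F -> lp_isomorphism p%:E lambda F v w ->
  exists a b : R, [/\ 0 <= a, 0 <= b, a * b <= lambda ^+ 2 &
    forall x, F x -> rnorm x <= a * lp_norm p%:E (v x) /\
                     lp_norm p%:E (v x) <= b * rnorm x].
Proof.
move=> p1 /subspace_lin[F0 Flin] [vlin wv vw].
set A := ereal_sup _; set B := ereal_sup _ => AB.
have v0 : v 0 = 0 := linear_on0 F0 vlin.
have w0 : w 0 = 0 by rewrite -v0 wv.
have FZ c x : F x -> F (c *: x) by move=> Fx; rewrite -[_ *: _]addr0; exact: Flin.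
have vZ c x : F x -> v (c *: x) = c *: v x.
  by move=> Fx; rewrite -[c *: x]addr0 vlin// v0 addr0.
have key x x' : F x -> F x' -> x != 0 -> x' != 0 ->
    rnorm x * lp_norm p%:E (v x') <= lambda * (rnorm x' * lp_norm p%:E (v x)).
  move=> Fx Fx' xn xn'.
  have nx : 0 < rnorm x by rewrite lt_neqAle eq_sym rnorm_eq0 xn rnorm_ge0.
  have nx' : 0 < rnorm x' by rewrite lt_neqAle eq_sym rnorm_eq0 xn' rnorm_ge0.
  have lx : 0 < lp_norm p%:E (v x).
    rewrite lt_neqAle lp_norm_ge0 andbT eq_sym; apply/eqP => /(lp_norm_eq0 p1) vx0.
    by move: xn; rewrite -(wv _ Fx) vx0 w0 eqxx.
  have hA : ((lp_norm p%:E (v x') / rnorm x')%:E <= A)%E.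
    apply: ereal_sup_ubound; exists (of_real k (rnorm x')^-1 *: x').
      split; first exact: FZ.
      by rewrite rnormZ rnorm_of_real ?invr_ge0 ?(ltW nx')// mulVf// gt_eqF.
    by rewrite vZ// lp_normZ ?invr_ge0 ?(ltW nx')// mulrC.
  have hB : ((rnorm x / lp_norm p%:E (v x))%:E <= B)%E.
    apply: ereal_sup_ubound; exists (of_real k (lp_norm p%:E (v x))^-1 *: v x).
      by rewrite /mkset lp_normZ ?invr_ge0 ?(ltW lx)// mulVf// gt_eqF.
    rewrite -vZ// wv; last exact: FZ.
    by rewrite rnormZ rnorm_of_real ?invr_ge0 ?(ltW lx)// mulrC.
  have := le_lt_trans (lee_pmul _ _ hA hB) AB.
  rewrite -EFinM !lee_fin lte_fin => /(_ _ _)/ltW hlt.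
  have := hlt (divr_ge0 (lp_norm_ge0 _ _) (ltW nx')) (divr_ge0 (ltW nx) (ltW lx)).
  rewrite mulf_div ler_pdivrMr ?mulr_gt0//.
  by rewrite [X in X <= _]mulrC.
have [[x0 [Fx0 xn0]]|] := pselect (exists x, F x /\ x != 0); last first.
  move=> nF; exists 0, 0; rewrite mulr0 sqr_ge0; split=> // x Fx.
  have -> : x = 0.
    by apply/eqP/negP => /negP xn; apply: nF; exists x.
  rewrite v0 lp_norm0// !mul0r; split=> //.
  by have /eqP -> : rnorm (0 : V) == 0 by rewrite rnorm_eq0.
have nx0 : 0 < rnorm x0 by rewrite lt_neqAle eq_sym rnorm_eq0 xn0 rnorm_ge0.
have lx0 : 0 < lp_norm p%:E (v x0).
  rewrite lt_neqAle lp_norm_ge0 andbT eq_sym; apply/eqP => /(lp_norm_eq0 p1) vx0.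
  by move: xn0; rewrite -(wv _ Fx0) vx0 w0 eqxx.
have l0 : 0 <= lambda.
  have := key x0 x0 Fx0 Fx0 xn0 xn0.
  rewrite -[leLHS]mul1r ler_pM2r ?mulr_gt0//; lra.
exists (lambda * (rnorm x0 / lp_norm p%:E (v x0))).
exists (lambda * (lp_norm p%:E (v x0) / rnorm x0)).
split; rewrite ?mulr_ge0 ?invr_ge0 ?(ltW nx0) ?(ltW lx0)//.
  rewrite mulrACA mulf_div (mulrC (rnorm x0)) divff ?mulr1//.
  by rewrite mulf_neq0// gt_eqF.
move=> x Fx; have [->|xn] := eqVneq x 0.
  have /eqP -> : rnorm (0 : V) == 0 by rewrite rnorm_eq0.
  by rewrite v0 lp_norm0// !mulr0.
set n0 := rnorm x0; set l0' := lp_norm _ (v x0).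
split.
  rewrite (_ : _ * _ * _ = lambda * (n0 * lp_norm p%:E (v x)) / l0'); last by ring.
  by rewrite ler_pdivlMr// key.
rewrite (_ : _ * _ * _ = lambda * (rnorm x * l0') / n0); last by ring.
by rewrite ler_pdivlMr// mulrC key.
Qed.

End Subspaces.

Section Cotype.
Variables (R : realType) (k : scalar_kind) (p q lambda : R).
Local Notation K := (scalars R k).

(** An L_p space with p at most 2 has cotype 2; by Jensen's inequality any
    moment of order q at least p may be used. *)
Lemma Lp_space_cotype2 (Z : normedModType K) :
  1 <= p -> p <= 2 -> p <= q -> Lp_space Z p%:E lambda ->
  exists2 C : R, 0 <= C & forall (I : finType) (z : I -> Z),
    (\sum_i rnorm (z i) ^+ 2) `^ 2^-1
    <= C * sign_mean (fun e => rnorm (\sum_i (-1) ^+ e i *: z i) `^ q) `^ q^-1.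
Proof.
move=> p1 p2 pq ZLp; have [c c0 hc] := @lp_norm_cotype2 R k p p1 p2.
have p0 : 0 < p by lra.
have q0 : 0 < q by lra.
exists (lambda ^+ 2 * c^-1 `^ p^-1) => [|I z].
  by rewrite mulr_ge0 ?sqr_ge0// powR_ge0.
have [d [E [Ed Ez]]] := seq_in_subspace (codom z).
have [n [F [Fn EF [v [w iso]]]]] := ZLp d E Ed.
have [a [b [a0 b0 ab hab]]] := lp_isomorphism_bounds p1 Fn iso.
have Fz i : F (z i) by apply: EF; apply: Ez; exact: codom_f.
have [F0 Flin] := subspace_lin Fn.
have [vlin wv _ _] := iso.
have v0 : v 0 = 0 := linear_on0 F0 vlin.
have Fsum (s : I -> K) :
    F (\sum_i s i *: z i) /\ v (\sum_i s i *: z i) = \sum_i s i *: v (z i).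
  elim/big_ind2 : _ => //= [_ x _ y [Fx <-] [Fy <-]|i _].
    have -> : x + y = 1 *: x + y by rewrite scale1r.
    by split; [exact: Flin|rewrite vlin// scale1r].
  split; rewrite -[s i *: z i]addr0; first exact: Flin.
  by rewrite vlin// v0 addr0.
pose L i := lp_norm p%:E (v (z i)).
have L0 i : 0 <= L i by exact: lp_norm_ge0.
have L20 : 0 <= \sum_i L i ^+ 2 by apply: sumr_ge0 => i _; rewrite sqr_ge0.
set M := sign_mean _.
have M0 : 0 <= M by apply: sign_mean_ge0 => e; rewrite powR_ge0.
have LM : (\sum_i L i ^+ 2) `^ 2^-1 <= c^-1 `^ p^-1 * b * M `^ q^-1.
  have h : c * (\sum_i L i ^+ 2) `^ (p / 2) <= b `^ p * M `^ (p / q).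
    apply: le_trans (hc I n (fun i => v (z i))) _.
    apply: (@le_trans _ _ (sign_mean (fun e => b `^ p *
        ((rnorm (\sum_i (-1) ^+ e i *: z i)) `^ q) `^ (p / q)))).
      apply: ler_sign_mean => e.
      have [FS vS] := Fsum (fun i => (-1) ^+ e i).
      rewrite -powRrM mulrCA mulfV ?gt_eqF// mulr1 -vS -powRM ?rnorm_ge0//.
      rewrite ge0_ler_powR ?nnegrE ?(ltW p0) ?lp_norm_ge0 ?mulr_ge0 ?rnorm_ge0//.
      by have [] := hab _ FS.
    rewrite sign_meanZ ler_wpM2l ?powR_ge0//.
    apply: sign_mean_jensen => [||e]; rewrite ?powR_ge0 ?divr_gt0//.
    by rewrite ler_pdivrMr// mul1r.
  have -> : (\sum_i L i ^+ 2) `^ 2^-1 = ((\sum_i L i ^+ 2) `^ (p / 2)) `^ p^-1.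
    by rewrite -powRrM mulrAC mulfV ?gt_eqF// mul1r.
  have -> : c^-1 `^ p^-1 * b * M `^ q^-1
      = (c^-1 * (b `^ p * M `^ (p / q))) `^ p^-1.
    clearbody M.
    rewrite !powRM ?mulr_ge0 ?invr_ge0 ?powR_ge0 ?(ltW c0)//.
    rewrite powRKV ?gt_eqF// -powRrM.
    by rewrite [p / q / p]mulrAC mulfV ?gt_eqF// mul1r mulrA.
  rewrite ge0_ler_powR ?nnegrE ?invr_ge0 ?mulr_ge0 ?powR_ge0 ?invr_ge0//;
    rewrite ?(ltW p0) ?(ltW c0)//.
  by rewrite [leRHS]mulrC ler_pdivlMr// [leLHS]mulrC.
apply: (@le_trans _ _ (a * (\sum_i L i ^+ 2) `^ 2^-1)).
  rewrite -[in leRHS](@powRKV _ a 2)// -powRM ?powR_ge0//.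
  rewrite ge0_ler_powR ?nnegrE ?mulr_ge0 ?powR_ge0//.
    by apply: sumr_ge0 => i _; rewrite sqr_ge0.
  rewrite powR_mulrn// mulr_sumr; apply: ler_sum => i _.
  rewrite -exprMn ler_sqr ?nnegrE ?mulr_ge0 ?rnorm_ge0//.
  by have [] := hab _ (Fz i).
apply: le_trans (ler_wpM2l a0 LM) _.
rewrite mulrA ler_wpM2r ?powR_ge0// mulrCA mulrC ler_wpM2r ?powR_ge0//.
Qed.

End Cotype.

(** * Comparison of the summing classes *)

Section Hoelder.
Variable R : realType.

(** Hoelder's inequality with exponents q / (q - 2) and q / 2, obtained from
    Jensen's inequality for the power 2 / q with weights proportional to
    [t i `^ q]. *)
Lemma hoelder_weights (I : finType) (q : R) (t a : I -> R) : 2 < q ->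
  (forall i, 0 <= t i) -> (forall i, 0 <= a i) ->
  \sum_i t i `^ (q - 2) * a i ^+ 2
  <= (\sum_i t i `^ q) `^ (1 - 2 / q) * (\sum_i a i `^ q) `^ (2 / q).
Proof.
move=> q2 t0 a0.
have q0 : 0 < q by lra.
have qn0 : q != 0 by rewrite gt_eqF.
have s0 : 0 < 2 / q by rewrite divr_gt0.
have s1 : 2 / q <= 1 by rewrite ler_pdivrMr// mul1r ltW.
have tq0 i : 0 <= t i `^ q by exact: powR_ge0.
set S := \sum_i t i `^ q.
have S0 : 0 <= S by exact: sumr_ge0.
have [Sz|Sn] := eqVneq S 0.
  rewrite big1 ?mulr_ge0 ?powR_ge0// => i _.
  have /eqP := Sz; rewrite psumr_eq0// => /allP/(_ i (mem_index_enum _))/=.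
  by move=> /eqP/powR_eq0_eq0 ->; rewrite powR0 ?mul0r//; apply/eqP; lra.
have Sp : 0 < S by rewrite lt_neqAle eq_sym Sn.
pose w i := t i `^ q / S.
have w0 i : 0 <= w i by rewrite divr_ge0.
have w1 : \sum_i w i = 1 by rewrite -mulr_suml mulfV.
pose u i := (a i / t i) `^ q.
have u0 i : 0 <= u i by exact: powR_ge0.
have E i : t i `^ (q - 2) * a i ^+ 2 = S * (w i * u i `^ (2 / q)).
  rewrite /w mulrA (mulrC S) divfK//.
  have [->|tn] := eqVneq (t i) 0.
    by rewrite !powR0 ?mul0r//; apply/eqP; lra.
  rewrite /u -powRrM.
  rewrite (_ : q * (2 / q) = 2); last by field.
  rewrite powR_mulrn ?divr_ge0//.
  rewrite powRB ?tn ?implybT// powR_mulrn// exprMn exprVn.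
  by ring.
under eq_bigr do rewrite E.
rewrite -mulr_sumr.
apply: (@le_trans _ _ (S * (\sum_i w i * u i) `^ (2 / q))).
  by rewrite ler_wpM2l// jensen_powR.
apply: (@le_trans _ _ (S * (S^-1 * \sum_i a i `^ q) `^ (2 / q))).
  rewrite ler_wpM2l// ge0_ler_powR ?nnegrE ?(ltW s0)//.
  - by apply: sumr_ge0 => i _; rewrite mulr_ge0.
  - by rewrite mulr_ge0 ?invr_ge0// sumr_ge0// => i _; exact: powR_ge0.
  rewrite mulr_sumr; apply: ler_sum => i _.
  have [tz|tn] := eqVneq (t i) 0.
    by rewrite /w tz powR0// !mul0r mulr_ge0 ?invr_ge0// powR_ge0.
  rewrite /w /u mulrAC -powRM ?divr_ge0// mulrC [t i * _]mulrC divfK//.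
rewrite powRM ?invr_ge0// ?sumr_ge0// => [|i _]; last exact: powR_ge0.
rewrite mulrA ler_wpM2r ?powR_ge0//.
rewrite -[S^-1]powR_inv1// -powRrM mulN1r.
by rewrite -[X in X * _ <= _](@powRr1 _ S)// -powRD// Sn implybT.
Qed.

End Hoelder.

Section Summing.
Variables (R : realType) (k : scalar_kind).
Local Notation K := (scalars R k).

Section FinTypeFamilies.
Variables (r : R) (m : nat) (X Y : normedModType K).

(** [summing_norm] for families indexed by arbitrary finite types. *)
Definition fin_summing_norm (I J : finType) (V : normedModType K)
    (l : I -> J -> K) (y : I -> J -> V) : R :=
  (\sum_j rnorm (\sum_i l j i *: y j i) `^ r) `^ r^-1.

Lemma fin_summing_normE (I J : finType) (V : normedModType K)
    (l : I -> J -> K) (y : I -> J -> V) :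
  fin_summing_norm l y
  = summing_norm r (fun (j : 'I_#|I|) (i : 'I_#|J|) =>
                      l (enum_val j) (enum_val i))
                   (fun j i => y (enum_val j) (enum_val i)).
Proof.
rewrite /fin_summing_norm (reindex _ (onW_bij _ (enum_val_bij I))).
congr (_ `^ _); apply: eq_bigr => j _; congr (rnorm _ `^ _).
by rewrite (reindex _ (onW_bij _ (enum_val_bij J))).
Qed.

Lemma summing_inequality_finType (P : X -> Y) (C : R) :
  (forall (m1 m2 : nat) (x : 'I_m1 -> 'I_m2 -> X) (l : 'I_m1 -> 'I_m2 -> K),
    (0 < m1)%N -> (0 < m2)%N ->
    ((summing_norm r l (fun j i => P (x j i)))%:E
     <= C%:E * ereal_sup [set (summing_norm r l (fun j i => h (x j i)))%:E
                         | h in @scalar_poly_ball R k m X])%E) ->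
  forall (I J : finType) (x : I -> J -> X) (l : I -> J -> K),
    (0 < #|I|)%N -> (0 < #|J|)%N ->
    ((fin_summing_norm l (fun j i => P (x j i)))%:E
     <= C%:E * ereal_sup [set (fin_summing_norm l (fun j i => h (x j i)))%:E
                         | h in @scalar_poly_ball R k m X])%E.
Proof.
move=> H I J x l I0 J0.
have := H _ _ (fun j i => x (enum_val j) (enum_val i))
              (fun j i => l (enum_val j) (enum_val i)) I0 J0.
rewrite fin_summing_normE => /le_trans; apply.
rewrite le_eqVlt; apply/orP; left; apply/eqP; congr (_ * ereal_sup _)%E.
by apply: eq_imagel => h _; rewrite fin_summing_normE.
Qed.

End FinTypeFamilies.

Section Inclusions.
Variables (m : nat) (X Y : normedModType K).

Lemma ereal_sup_le_scale (T : Type) (B : set T) (f g : T -> R) (D : R) :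
  0 <= D -> (forall h, B h -> f h <= D * g h) ->
  (ereal_sup [set (f h)%:E | h in B] <= D%:E * ereal_sup [set (g h)%:E | h in B])%E.
Proof.
move=> D0 fg; apply: ge_ereal_sup => _ [h Bh <-].
apply: (@le_trans _ _ (D%:E * (g h)%:E)%E); first by rewrite -EFinM lee_fin fg.
by apply: lee_wpmul2l; rewrite ?lee_fin//; apply: ereal_sup_ubound; exists h.
Qed.

Lemma scalar_poly_ball0 : @scalar_poly_ball R k m X (fun=> 0).
Proof.
split; first split; first exact: cst_continuous.
  exists (fun=> 0); split=> // i x a u v.
  by rewrite scaler0 addr0.
apply: ge_ereal_sup => _ [x _ <-].
have /eqP -> : rnorm (0 : K^o) == 0 by rewrite rnorm_eq0.
by rewrite lee_fin ler01.
Qed.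

(** Each row is rescaled by the power q/2 - 1 of the norm of its image under P,
    which turns the q-th power sum of the images into a sum of squares. *)
Lemma factorable_summing2_sub (q : R) : 2 < q ->
  factorable_strongly_summing 2 m X Y `<=` factorable_strongly_summing q m X Y.
Proof.
move=> q2 P [Ppol [C [C0 HC]]]; split; first exact: Ppol.
exists C; split; first exact: C0.
move=> m1 m2 x l m10 m20.
have q0 : 0 < q by lra.
have qn0 : q != 0 by rewrite gt_eqF.
pose t j := rnorm (\sum_i l j i *: P (x j i)).
have t0 j : 0 <= t j by exact: rnorm_ge0.
pose S := \sum_j t j `^ q.
have S0 : 0 <= S by apply: sumr_ge0 => j _; exact: powR_ge0.
have -> : summing_norm q l (fun j i => P (x j i)) = S `^ q^-1 by [].
set A := ereal_sup _.
have [Sz|Sn] := eqVneq S 0.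
  rewrite Sz powR0 ?invr_eq0//; apply: mule_ge0; rewrite ?lee_fin//.
  apply: (@le_trans _ _ (summing_norm q l (fun j i => (0 : K^o)))%:E).
    by rewrite lee_fin powR_ge0.
  by apply: ereal_sup_ubound; exists (fun=> 0) => //; exact: scalar_poly_ball0.
have Sp : 0 < S by rewrite lt_neqAle eq_sym Sn.
pose d j := t j `^ (q / 2 - 1).
have d0 j : 0 <= d j by exact: powR_ge0.
have scaleE (V : normedModType K) (y : 'I_m1 -> 'I_m2 -> V) :
    summing_norm 2 (fun j i => of_real k (d j) * l j i) y
    = (\sum_j t j `^ (q - 2) * rnorm (\sum_i l j i *: y j i) ^+ 2) `^ 2^-1.
  congr (_ `^ _); apply: eq_bigr => j _.
  under eq_bigr do rewrite -scalerA.
  rewrite -scaler_sumr rnormZ rnorm_of_real// powR_mulrn ?mulr_ge0 ?rnorm_ge0//.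
  rewrite exprMn -[d j ^+ 2]powR_mulrn// -powRrM; congr (_ `^ _ * _).
  by rewrite mulrBl divfK// mul1r.
(* the Hoelder factor lost on the right-hand side is gained on the left *)
pose D := S `^ (2^-1 - q^-1).
have Dp : 0 < D by exact: powR_gt0.
have := HC _ _ x (fun j i => of_real k (d j) * l j i) m10 m20.
rewrite scaleE.
have -> : \sum_j t j `^ (q - 2) * rnorm (\sum_i l j i *: P (x j i)) ^+ 2 = S.
  apply: eq_bigr => j _; rewrite -/(t j) -powR_mulrn// -powRD ?subrK//.
  by rewrite (negbTE qn0).
move=> HS.
have HD : (ereal_sup [set (summing_norm 2 (fun j i => of_real k (d j) * l j i)
             (fun j i => h (x j i)))%:E | h in @scalar_poly_ball R k m X]
           <= D%:E * A)%E.
  apply: ereal_sup_le_scale => [|h _]; first exact: ltW.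
  rewrite scaleE.
  pose a j := rnorm (\sum_i l j i *: h (x j i)).
  have a0 j : 0 <= a j by exact: rnorm_ge0.
  have ta := hoelder_weights q2 t0 a0.
  apply: (@le_trans _ _ ((S `^ (1 - 2 / q) * (\sum_j a j `^ q) `^ (2 / q)) `^ 2^-1)).
    rewrite ge0_ler_powR ?nnegrE ?mulr_ge0 ?powR_ge0 ?invr_ge0//.
    by apply: sumr_ge0 => j _; rewrite mulr_ge0 ?powR_ge0 ?sqr_ge0.
  have e1 : (1 - 2 / q) / 2 = 2^-1 - q^-1 by field.
  have e2 : 2 / q / 2 = q^-1 by field.
  have e3 (u v : R) : (u `^ (1 - 2 / q) * v `^ (2 / q)) `^ 2^-1
      = u `^ (2^-1 - q^-1) * v `^ q^-1.
    by rewrite powRM ?powR_ge0// -!powRrM e1 e2.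
  by rewrite e3; exact: lexx.
have {}HS := le_trans HS (lee_wpmul2l (_ : (0 <= C%:E)%E) HD).
have -> : S `^ q^-1 = D^-1 * S `^ 2^-1.
  rewrite -powRN -powRD ?Sn ?implybT//; congr (_ `^ _); ring.
rewrite EFinM; apply: le_trans (lee_wpmul2l _ (HS _)) _; rewrite ?lee_fin//.
  by rewrite invr_ge0 ltW.
by rewrite muleCA (muleA D^-1%:E) -EFinM mulVf ?gt_eqF// mul1e.
Qed.

(** Apply the q-summing inequality to the rows obtained from all choices of
    signs in the given family: the left-hand side dominates the square sum by
    cotype 2, the right-hand side is controlled by Khintchine's inequality. *)
Lemma factorable_summing_cotype2 (q C2 : R) : 0 < q -> 0 <= C2 ->
  (forall (I : finType) (y : I -> Y),
    (\sum_i rnorm (y i) ^+ 2) `^ 2^-1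
    <= C2 * sign_mean (fun e => rnorm (\sum_i (-1) ^+ e i *: y i) `^ q) `^ q^-1) ->
  factorable_strongly_summing q m X Y `<=` factorable_strongly_summing 2 m X Y.
Proof.
move=> q0 C20 cot P [Ppol [C [C0 HC]]]; split; first exact: Ppol.
have qn0 : q != 0 by rewrite gt_eqF.
have [B B0 hB] := @khintchine_le R k q q0.
have Bq0 : 0 <= B `^ q^-1 by exact: powR_ge0.
exists (C2 * (C * B `^ q^-1)); split; first by rewrite !mulr_ge0.
move=> m1 m2 x l m10 m20.
pose signs : finType := {ffun 'I_m1 -> bool}.
pose N : R := #|{: signs}|%:R.
have Np : 0 < N by rewrite ltr0n card_signs_gt0.
(* rows are indexed by the signs; row e represents the sum over j of
   (-1) ^+ e j times the j-th element of the given family *)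
pose x' (e : signs) (ji : 'I_m1 * 'I_m2) := x ji.1 ji.2.
pose l' (e : signs) (ji : 'I_m1 * 'I_m2) : K := (-1) ^+ e ji.1 * l ji.1 ji.2.
pose z (V : normedModType K) (f : X -> V) (j : 'I_m1) := \sum_i l j i *: f (x j i).
have signE (V : normedModType K) (f : X -> V) :
    fin_summing_norm q l' (fun e ji => f (x' e ji))
    = N `^ q^-1 *
      sign_mean (fun e => rnorm (\sum_j (-1) ^+ e j *: z V f j) `^ q) `^ q^-1.
  rewrite -powRM ?(ltW Np)//; last first.
    by apply: sign_mean_ge0 => e; exact: powR_ge0.
  rewrite card_sign_mean; congr (_ `^ _).
  apply: eq_bigr => e _; congr (rnorm _ `^ _).
  under [RHS]eq_bigr do rewrite scaler_sumr.
  rewrite pair_bigA; apply: eq_bigr => ji _.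
  by rewrite scalerA.
have norm2E (V : normedModType K) (f : X -> V) :
    summing_norm 2 l (fun j i => f (x j i)) = (\sum_j rnorm (z V f j) ^+ 2) `^ 2^-1.
  congr (_ `^ _); apply: eq_bigr => j _.
  by rewrite powR_mulrn// rnorm_ge0.
have J0 : (0 < #|{: 'I_m1 * 'I_m2}|)%N by rewrite card_prod !card_ord muln_gt0 m10.
have := summing_inequality_finType HC x' l' (card_signs_gt0 _) J0.
set A := ereal_sup _ => HA.
set A2 := ereal_sup _.
have AA2 : (A <= (N `^ q^-1 * B `^ q^-1)%:E * A2)%E.
  apply: ereal_sup_le_scale => [|h _]; first by rewrite mulr_ge0 ?powR_ge0.
  rewrite signE norm2E -mulrA ler_wpM2l ?powR_ge0//.
  set s := \sum_j _ ^+ 2.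
  have s0 : 0 <= s by apply: sumr_ge0 => j _; rewrite sqr_ge0.
  have -> : B `^ q^-1 * s `^ 2^-1 = (B * s `^ (q / 2)) `^ q^-1.
    by rewrite powRM ?powR_ge0// -powRrM mulrAC mulfV// mul1r.
  apply: ge0_ler_powR; rewrite ?nnegrE; last exact: hB.
  - by rewrite invr_ge0 ltW.
  - by apply: sign_mean_ge0 => e; exact: powR_ge0.
  - by rewrite mulr_ge0 ?powR_ge0.
rewrite norm2E.
apply: (@le_trans _ _ ((C2 * (N `^ q^-1)^-1)%:E *
    (fin_summing_norm q l' (fun e ji => P (x' e ji)))%:E)%E).
  by rewrite -EFinM lee_fin signE -mulrA mulKf ?gt_eqF ?powR_gt0//.
apply: (@le_trans _ _ ((C2 * (N `^ q^-1)^-1)%:E *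
    (C%:E * ((N `^ q^-1 * B `^ q^-1)%:E * A2)))%E).
  apply: lee_wpmul2l.
    by rewrite lee_fin mulr_ge0// invr_ge0 powR_ge0.
  by apply: le_trans HA _; apply: lee_wpmul2l.
rewrite !muleA -!EFinM le_eqVlt; apply/orP; left; apply/eqP.
congr (_%:E * _)%E; field.
by rewrite gt_eqF// powR_gt0.
Qed.

End Inclusions.
End Summing.

(* Y is a closed subspace of Z: a Banach space with a linear isometric
   embedding j into Z. *)
Theorem theorem5p3 (R : realType) (k : scalar_kind) (p q lambda : R) (m : nat)
    (X Y Z : completeNormedModType (scalars R k)) (j : {linear Y -> Z}) :
  1 <= p -> p <= 2 -> 2 < q -> 1 < lambda -> (1 <= m)%N ->
  Lp_space Z p%:E lambda ->
  (forall y : Y, `|j y| = `|y|) ->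
  factorable_strongly_summing q m X Y = factorable_strongly_summing 2 m X Y.
Proof.
move=> p1 p2 q2 _ _ ZLp jiso.
have jn y : rnorm (j y) = rnorm y by rewrite /rnorm jiso.
have [C C0 cotZ] := Lp_space_cotype2 p1 p2 (le_trans p2 (ltW q2)) ZLp.
apply/seteqP; split; last exact: factorable_summing2_sub.
apply: (@factorable_summing_cotype2 _ _ _ _ _ q C) => // [|I y].
  exact: lt_trans q2.
have := cotZ I (fun i => j (y i)).
under eq_bigr do rewrite jn.
rewrite (@eq_sign_mean _ _ _
  (fun e => rnorm (\sum_i (-1) ^+ e i *: y i) `^ q))// => e.
rewrite -jn linear_sum; congr (rnorm _ `^ _).
by apply: eq_bigr => i _; rewrite linearZ.
Qed.
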